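(* Assume that the dual function $d$ (defined in the context) has a unique maximizer $\lambda^\ast$ over $\Pi$, and that there is $L_{\mathrm p}>0$ with $d(\lambda^\ast)\ge d(\lambda)+L_{\mathrm p}\|\lambda-\lambda^\ast\|$ for all $\lambda\in\Pi$. Let $V>0$, $$B_{\mathrm p}(V)=\max\left\{\frac{L_{\mathrm p}}{2V},\frac{2C}{VL_{\mathrm p}}\right\},\qquad \mathcal R_{\mathrm p}(V)=\left\{\lambda\in\Pi:\|\lambda-\lambda^\ast\|\le B_{\mathrm p}(V)+\frac{\sqrt{2C}}{V}\right\}.$$ Let $\{x(t),y(t),w(t),z(t)\}_{t=0}^\infty$ be generated by the dual subgradient algorithm with parameter $V$ (described in the context), let $\lambda(t)=(w(t),z(t))$, let $T_{\mathrm p}=\inf\{t\ge0:\lambda(t)\in\mathcal R_{\mathrm p}(V)\}$ be the first iteration at which $\lambda(t)$ lies in $\mathcal R_{\mathrm p}(V)$, and for an integer $T>0$ let $\overline{x_{T_{\mathrm p}}}(T)=\frac1T\sum_{t=T_{\mathrm p}}^{T_{\mathrm p}+T-1}x(t)$. Then for every integer $T>0$, $$f(\overline{x_{T_{\mathrm p}}}(T))-f^{(\mathrm{opt})}\le\frac CV+\frac{2VM}{T}\left[\frac{\sqrt{2C}}V+B_{\mathrm p}(V)\right]+\frac{V}{2T}\left\{\left[\frac{\sqrt{2C}}V+B_{\mathrm p}(V)\right]^2+4\|\lambda^\ast\|\left[\frac{\sqrt{2C}}V+B_{\mathrm p}(V)\right]\right\},$$ and, for every $j\in\{1,\dots,J\}$,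 $$g_j(\overline{x_{T_{\mathrm p}}}(T))\le\frac{2V(1+M)}{T}\left[\frac{\sqrt{2C}}V+B_{\mathrm p}(V)\right].$$
   Context: Setting. $I,J$ are positive integers. $\mathcal X\subset\mathbb R^I$ is a nonempty closed bounded set (possibly non-convex or discrete) and $\overline{\mathcal X}$ is its convex hull. $\mathcal Y\subset\mathbb R^I$ is closed, bounded, convex and contains $\overline{\mathcal X}$. The functions $f,g_1,\dots,g_J:\mathcal Y\to\mathbb R$ are convex and Lipschitz continuous with a common constant $M>0$: $|f(x)-f(y)|\le M\|x-y\|$ and $|g_j(x)-g_j(y)|\le M\|x-y\|$ for all $x,y\in\mathcal Y$ (all norms are Euclidean). Write $g(y)=(g_1(y),\dots,g_J(y))$. $C>0$ is a constant with $\|g(y)\|^2\le C$ and $\|x-y\|^2\le C$ for all $x\in\overline{\mathcal X}$, $y\in\mathcal Y$. $f^{(\mathrm{opt})}$ is the optimal value of: minimize $f(x)$ subject to $g_j(x)\le 0$ for $j=1,\dots,J$ and $x\in\overline{\mathcal X}$. Dual function: $\Pi=\mathbb R_+^J\times\mathbb R^I$ with $\mathbb R_+=[0,\infty)$, and for $\lambda=(w,z)\in\Pi$, $d(\lambda)=d(w,z)=\inf_{x\in\overline{\mathcal X},\,y\in\mathcal Y}\left[f(y)+w^\top g(y)+z^\top(x-y)\right]$. Dual subgradient algorithm with parameter $V>0$: start from any $w(0)\in\mathbb R_+^J$, $z(0)\in\mathbb R^I$. For $t=0,1,2,\dots$: choose $x(t)\in\mathcal X$ minimizing $x\mapsto z(t)^\top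 x$ over $\overline{\mathcal X}$; choose $y(t)\in\mathcal Y$ minimizing $y\mapsto f(y)+w(t)^\top g(y)-z(t)^\top y$ over $\mathcal Y$; set $w(t+1)=[w(t)+\frac1V g(y(t))]_+$ (componentwise positive part) and $z(t+1)=z(t)+\frac1V[x(t)-y(t)]$. *)

(* Defs.v *)
From HB Require Import structures.
From mathcomp Require Export all_boot all_order all_algebra.
From mathcomp Require Export all_classical all_reals all_analysis.
Export Order.TTheory GRing.Theory Num.Theory.
Export numFieldNormedType.Exports.

Set Implicit Arguments.
Unset Strict Implicit.
Unset Printing Implicit Defensive.

Local Open Scope classical_set_scope.
Local Open Scope ring_scope.

(* Vectors of R^n are row vectors. The norm that MathComp-Analysis puts on
   matrices is the sup norm, which has the Euclidean topology and the Euclidean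
   bounded sets; [closed] and [bounded_set] are therefore the library's, while
   every quantitative estimate is stated with [enorm] or [pnorm]. *)

Definition dot (R : realType) (n : nat) (u v : 'rV[R]_n) : R :=
  \sum_(i < n) u 0 i * v 0 i.

Definition enorm (R : realType) (n : nat) (u : 'rV[R]_n) : R :=
  Num.sqrt (dot u u).

(* Euclidean norm on R^J x R^I = R^(J + I). *)
Definition pnorm (R : realType) (J I : nat) (l : 'rV[R]_J * 'rV[R]_I) : R :=
  Num.sqrt (enorm l.1 ^+ 2 + enorm l.2 ^+ 2).

Definition convex_hull (R : realType) (n : nat) (A : set 'rV[R]_n) :
    set 'rV[R]_n :=
  smallest (@convex_set R 'rV[R]_n) A.

Definition lipschitz_in (R : realType) (n : nat) (M : R) (A : set 'rV[R]_n)
    (h : 'rV[R]_n -> R) : Prop :=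
  forall x y, A x -> A y -> `|h x - h y| <= M * enorm (x - y).

(* The value is +oo when the program is infeasible. *)
Definition opt_value (R : realType) (I J : nat) (X : set 'rV[R]_I)
    (f : 'rV[R]_I -> R) (g : 'rV[R]_I -> 'rV[R]_J) : \bar R :=
  ereal_inf [set (f x)%:E | x in
    [set x | convex_hull X x /\ forall j : 'I_J, g x 0 j <= 0]].

Definition dual_domain (R : realType) (J I : nat) :
    set ('rV[R]_J * 'rV[R]_I) :=
  [set l : 'rV[R]_J * 'rV[R]_I | forall j : 'I_J, 0 <= l.1 0 j].

(* The real-valued [inf] is the infimum as soon as X is nonempty, Y is bounded
   and contains the convex hull of X, and f, g are Lipschitz on Y. *)
Definition dual_function (R : realType) (I J : nat) (X Y : set 'rV[R]_I)
    (f : 'rV[R]_I -> R) (g : 'rV[R]_I -> 'rV[R]_J)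
    (l : 'rV[R]_J * 'rV[R]_I) : R :=
  inf [set f y + dot l.1 (g y) + dot l.2 (x - y)
      | x in convex_hull X & y in Y].

Definition is_unique_maximizer (R : realType) (T : Type) (A : set T)
    (h : T -> R) (a : T) : Prop :=
  [/\ A a, forall b, A b -> h b <= h a
    & forall a', A a' -> (forall b, A b -> h b <= h a') -> a' = a].

Definition is_minimizer (R : realType) (T : Type) (A : set T) (h : T -> R)
    (a : T) : Prop :=
  A a /\ forall b, A b -> h a <= h b.

(* [is_minimizer] is over the convex hull, but x t is required to lie in X
   itself. *)
Definition dual_subgradient_run (R : realType) (I J : nat)
    (X Y : set 'rV[R]_I) (f : 'rV[R]_I -> R) (g : 'rV[R]_I -> 'rV[R]_J)
    (V : R) (x y : nat -> 'rV[R]_I) (w : nat -> 'rV[R]_J)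
    (z : nat -> 'rV[R]_I) : Prop :=
  (forall j : 'I_J, 0 <= w 0%N 0 j) /\
  forall t : nat,
    [/\ X (x t) /\ is_minimizer (convex_hull X) (dot (z t)) (x t),
        is_minimizer Y (fun y' => f y' + dot (w t) (g y') - dot (z t) y') (y t),
        w t.+1 = map_mx (Num.max 0) (w t + V^-1 *: g (y t))
      & z t.+1 = z t + V^-1 *: (x t - y t)].

Definition Bp (R : realType) (C Lp V : R) : R :=
  Num.max (Lp / (2 * V)) (2 * C / (V * Lp)).

Definition Rp (R : realType) (J I : nat) (C Lp V : R)
    (lstar : 'rV[R]_J * 'rV[R]_I) : set ('rV[R]_J * 'rV[R]_I) :=
  [set l : 'rV[R]_J * 'rV[R]_I | dual_domain l /\
           pnorm (l - lstar) <= Bp C Lp V + Num.sqrt (2 * C) / V].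

Definition is_first_hit (T : Type) (A : set T) (u : nat -> T) (n : nat) : Prop :=
  A (u n) /\ forall t : nat, (t < n)%N -> ~ A (u t).

Definition average_from (R : realType) (n : nat) (x : nat -> 'rV[R]_n)
    (t0 T : nat) : 'rV[R]_n :=
  T%:R^-1 *: \sum_(t0 <= t < t0 + T) x t.

(* Main.v *)
Require Import Defs.
From mathcomp Require Import ring lra.

(** A step moves lambda = (w, z) along (g(y), x - y) / V, a subgradient of the
concave dual function, followed by a projection onto the dual domain. With the
polyhedral growth of d this gives, for e = ||lambda - lambda*||,
  e(t+1)^2 <= e(t)^2 - 2 (Lp / V) e(t) + 2C / V^2,
so that e drops by at least Lp / (2V) as long as e >= Bp(V), while a single step
never increases it by more than sqrt(2C) / V: the ball Rp(V) is reached and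
never left. From Tp on, the telescoped updates of w and z bound the constraint
violation and the gap between the averages of x and of y by differences of two
iterates in that ball. Telescoping ||lambda||^2 and weak duality bound the mean of
f(y(t)), and Jensen's inequality and the Lipschitz bounds conclude. *)

Set Implicit Arguments.
Unset Strict Implicit.
Unset Printing Implicit Defensive.

Local Open Scope classical_set_scope.
Local Open Scope ring_scope.

(** * Euclidean inner product and norm *)

Section Dot.
Variables (R : realType) (n : nat).
Implicit Types (u v a : 'rV[R]_n) (c : R).

Lemma dotC u v : dot u v = dot v u.
Proof. by apply: eq_bigr => i _; rewrite mulrC. Qed.

Lemma dotDl u v a : dot (u + v) a = dot u a + dot v a.
Proof. by rewrite -big_split; apply: eq_bigr => i _; rewrite mxE mulrDl. Qed.

Lemma dotZl c u v : dot (c *: u) v = c * dot u v.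
Proof. by rewrite /dot mulr_sumr; apply: eq_bigr => i _; rewrite mxE mulrA. Qed.

Lemma dotNl u v : dot (- u) v = - dot u v.
Proof. by rewrite -scaleN1r dotZl mulN1r. Qed.

Lemma dotDr u v a : dot a (u + v) = dot a u + dot a v.
Proof. by rewrite !(dotC a) dotDl. Qed.

Lemma dotZr c u v : dot v (c *: u) = c * dot v u.
Proof. by rewrite !(dotC v) dotZl. Qed.

Lemma dotNr u v : dot v (- u) = - dot v u.
Proof. by rewrite !(dotC v) dotNl. Qed.

Definition dotE := (dotDl, dotDr, dotNl, dotNr, dotZl, dotZr).

Lemma dot_ge0 u : 0 <= dot u u.
Proof. by apply: sumr_ge0 => i _; rewrite -expr2 sqr_ge0. Qed.

Lemma enorm_ge0 u : 0 <= enorm u.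
Proof. exact: sqrtr_ge0. Qed.

Lemma enorm_sqr u : enorm u ^+ 2 = dot u u.
Proof. exact/sqr_sqrtr/dot_ge0. Qed.

Lemma le_enorm u c : 0 <= c -> dot u u <= c ^+ 2 -> enorm u <= c.
Proof.
by move=> c0 uc; rewrite -(@ler_pXn2r _ 2) ?nnegrE ?enorm_ge0// enorm_sqr.
Qed.

Lemma enorm_eq0 u : enorm u = 0 -> u = 0.
Proof.
move=> u0; have := enorm_sqr u; rewrite u0 expr0n /= => /esym/eqP.
rewrite psumr_eq0 => [/allP h|i _]; last by rewrite -expr2 sqr_ge0.
apply/rowP => i; rewrite mxE; apply/eqP.
by have := h i; rewrite mem_index_enum mulf_eq0 orbb => /(_ isT).
Qed.

(** Expand the squared norm of [enorm v *: u - enorm u *: v] and cancel the factor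
    [2 * enorm u * enorm v]; zero vectors are set apart to allow this. *)
Lemma cauchy_schwarz u v : dot u v <= enorm u * enorm v.
Proof.
have [/enorm_eq0->|u0] := eqVneq (enorm u) 0.
  by rewrite -(scale0r 0) dotZl mul0r mulr_ge0 ?enorm_ge0.
have [/enorm_eq0->|v0] := eqVneq (enorm v) 0.
  by rewrite -(scale0r 0) dotZr mul0r mulr_ge0 ?enorm_ge0.
have up : 0 < enorm u by rewrite lt_neqAle eq_sym u0 enorm_ge0.
have vp : 0 < enorm v by rewrite lt_neqAle eq_sym v0 enorm_ge0.
have := dot_ge0 (enorm v *: u - enorm u *: v).
rewrite !dotE (dotC v u) -!enorm_sqr => h.
have : 0 <= (2 * (enorm u * enorm v)) * (enorm u * enorm v - dot u v) by lra.
by rewrite pmulr_rge0 ?subr_ge0// !mulr_gt0.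
Qed.

Lemma dot_ge u v : - (enorm u * enorm v) <= dot u v.
Proof.
have := cauchy_schwarz (- u) v.
by rewrite {1}/enorm !dotE opprK -/(enorm u) lerNl.
Qed.

Lemma enormN u : enorm (- u) = enorm u.
Proof. by rewrite /enorm !dotE opprK. Qed.

Lemma enormZ c u : 0 <= c -> enorm (c *: u) = c * enorm u.
Proof.
move=> c0; rewrite /enorm !dotE mulrA -expr2 sqrtrM ?sqr_ge0//.
by rewrite sqrtr_sqr ger0_norm.
Qed.

Lemma enormD u v : enorm (u + v) <= enorm u + enorm v.
Proof.
apply: le_enorm; first by rewrite addr_ge0 ?enorm_ge0.
by rewrite sqrrD !dotE !enorm_sqr (dotC v u); have := cauchy_schwarz u v; lra.
Qed.

Lemma le_coord_enorm u i : u 0 i <= enorm u.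
Proof.
apply: (le_trans (ler_norm _)).
rewrite -(@ler_pXn2r _ 2) ?nnegrE ?enorm_ge0// enorm_sqr real_normK ?num_real//.
rewrite /dot (bigD1 i)//= -expr2 lerDl.
by apply: sumr_ge0 => k _; rewrite -expr2 sqr_ge0.
Qed.

Lemma enorm_sqrBZ u v a c :
  enorm (u + c *: v - a) ^+ 2 =
  enorm (u - a) ^+ 2 + 2 * c * dot (u - a) v + c ^+ 2 * enorm v ^+ 2.
Proof. by rewrite !enorm_sqr !dotE (dotC v u) (dotC v a); ring. Qed.

(** Recentre both squares at [a]: the cross terms combine into [2 * dot a (u - v)], and [u - v] has
    norm at most [2 * k]. With [a] the dual optimum this yields the braces of the objective
    bound. *)
Lemma enorm_sqr_sub_le (k : R) u v a :
  enorm (u - a) <= k -> enorm (v - a) <= k ->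
  enorm u ^+ 2 - enorm v ^+ 2 <= k ^+ 2 + 4 * enorm a * k.
Proof.
move=> uk vk.
have -> : enorm u ^+ 2 - enorm v ^+ 2
    = enorm (u - a) ^+ 2 - enorm (v - a) ^+ 2 + 2 * dot a (u - a - (v - a)).
  by rewrite !enorm_sqr !dotE (dotC v a) (dotC u a); ring.
have k0 : 0 <= k by exact: le_trans (enorm_ge0 _) uk.
have uk2 : enorm (u - a) ^+ 2 <= k ^+ 2 by rewrite lerXn2r ?nnegrE ?enorm_ge0.
have v2 := sqr_ge0 (enorm (v - a)).
have h1 := cauchy_schwarz a (u - a - (v - a)).
have h2 : enorm (u - a - (v - a)) <= 2 * k.
  apply: (le_trans (enormD _ _)); rewrite enormN; lra.
have h3 := ler_wpM2l (enorm_ge0 a) h2.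
lra.
Qed.

(** Projecting onto the nonnegative orthant does not move away from a point of the orthant; this
    holds coordinate by coordinate. *)
Lemma enorm_map_max0 u a : (forall i, 0 <= a 0 i) ->
  enorm (map_mx (Num.max 0) u - a) ^+ 2 <= enorm (u - a) ^+ 2.
Proof.
move=> a0; rewrite !enorm_sqr; apply: ler_sum => i _; rewrite !mxE.
by have := a0 i; case: (leP 0 (u 0 i)) => // ? ?; nra.
Qed.

End Dot.

(** * Pairs of multipliers as concatenated vectors, so that the Euclidean lemmas apply to them *)

Section PairNorm.
Variables (R : realType) (J I : nat).
Implicit Types (a c : 'rV[R]_J) (b d : 'rV[R]_I).

Lemma dot_row_mx a b c d :
  dot (row_mx a b) (row_mx c d) = dot a c + dot b d.
Proof.
rewrite /dot big_split_ord /=; congr (_ + _); apply: eq_bigr => i _.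
  by rewrite !row_mxEl.
by rewrite !row_mxEr.
Qed.

Lemma enorm_row_mx a b : enorm (row_mx a b) ^+ 2 = enorm a ^+ 2 + enorm b ^+ 2.
Proof. by rewrite !enorm_sqr dot_row_mx. Qed.

Lemma pnormE (l : 'rV[R]_J * 'rV[R]_I) : pnorm l = enorm (row_mx l.1 l.2).
Proof. by rewrite /pnorm -enorm_row_mx sqrtr_sqr ger0_norm ?enorm_ge0. Qed.

Lemma subr_row_mx a b c d : row_mx a b - row_mx c d = row_mx (a - c) (b - d).
Proof. by rewrite opp_row_mx add_row_mx. Qed.

Lemma enorm_row_mx_l a b : enorm a <= enorm (row_mx a b).
Proof.
apply: le_enorm; first exact: enorm_ge0.
by rewrite enorm_row_mx enorm_sqr lerDl sqr_ge0.
Qed.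

Lemma enorm_row_mx_r a b : enorm b <= enorm (row_mx a b).
Proof.
apply: le_enorm; first exact: enorm_ge0.
by rewrite enorm_row_mx !enorm_sqr lerDr dot_ge0.
Qed.

End PairNorm.

(** * Convexity, running averages and Jensen's inequality *)

Section Averages.
Variables (R : realType) (n : nat).
Implicit Types (A : set 'rV[R]_n) (u : nat -> 'rV[R]_n).

Lemma convex_setP A (a b : 'rV[R]_n) (p : R) :
  @convex_set R 'rV[R]_n A -> 0 <= p -> p <= 1 -> A a -> A b ->
  A (p *: a + (1 - p) *: b).
Proof.
move=> cA p0 p1 Aa Ab.
by have := cA a b (Itv01 p0 p1); rewrite !inE; apply.
Qed.

Lemma convex_functionP A h (a b : 'rV[R]_n) (p : R) :
  @convex_function R 'rV[R]_n A h -> 0 <= p -> p <= 1 -> A a -> A b ->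
  h (p *: a + (1 - p) *: b) <= p * h a + (1 - p) * h b.
Proof.
move=> ch p0 p1 Aa Ab.
by have := ch (Itv01 p0 p1) a b; rewrite !inE; apply.
Qed.

Lemma convex_hull_convex A : @convex_set R 'rV[R]_n (convex_hull A).
Proof.
move=> a b p; rewrite !inE => ha hb B [cB AB].
by have := cB a b p; rewrite !inE; apply; [apply: ha|apply: hb].
Qed.

Lemma average_from1 u t0 : average_from u t0 1 = u t0.
Proof. by rewrite /average_from addn1 big_nat1 invr1 scale1r. Qed.

(** Each average is a convex combination of the previous one and the new point, which reduces
    membership and Jensen to two-point convexity by induction. *)
Lemma average_fromS u t0 T :
  average_from u t0 T.+2 =
  (T.+1%:R / T.+2%:R) *: average_from u t0 T.+1 +
  (1 - T.+1%:R / T.+2%:R) *: u (t0 + T.+1)%N.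
Proof.
rewrite /average_from addnS big_nat_recr ?leq_addr//= scalerDr scalerA.
by congr (_ *: _ + _ *: _); field; rewrite -?natrD ?nat1r ?pnatr_eq0.
Qed.

Let weight01 T : 0 <= T.+1%:R / T.+2%:R :> R /\ T.+1%:R / T.+2%:R <= 1 :> R.
Proof. by rewrite divr_ge0//= ler_pdivrMr// mul1r ler_nat. Qed.

Lemma average_from_in A u t0 T : @convex_set R 'rV[R]_n A ->
  (forall t, A (u t)) -> A (average_from u t0 T.+1).
Proof.
move=> cA Au; elim: T => [|T IH]; first by rewrite average_from1.
by have [p0 p1] := weight01 T; rewrite average_fromS; apply: convex_setP.
Qed.

Lemma jensen_average_from A h u t0 T : @convex_set R 'rV[R]_n A ->
  @convex_function R 'rV[R]_n A h -> (forall t, A (u t)) ->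
  h (average_from u t0 T.+1) <= T.+1%:R^-1 * \sum_(t0 <= t < t0 + T.+1) h (u t).
Proof.
move=> cA ch Au; elim: T => [|T IH].
  by rewrite average_from1 addn1 big_nat1 invr1 mul1r.
have [p0 p1] := weight01 T; rewrite average_fromS.
apply: le_trans (convex_functionP ch p0 p1 _ _) _ => //.
  exact: average_from_in.
apply: le_trans (lerD (ler_wpM2l p0 IH) (lexx _)) _.
rewrite [in leRHS]addnS big_nat_recr ?leq_addr//=.
by rewrite le_eqVlt; apply/orP; left; apply/eqP; field; rewrite -?natrD ?nat1r ?pnatr_eq0.
Qed.

End Averages.

(** * Scalar recursion for the distance to the dual optimum *)

Section Descent.
Variables (R : realType) (e : nat -> R) (r c : R).
Hypotheses (r_gt0 : 0 < r) (c_gt0 : 0 < c) (e_ge0 : forall t, 0 <= e t).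
Hypothesis e_step : forall t, e t.+1 ^+ 2 <= e t ^+ 2 - 2 * r * e t + c.

(** For [r = Lp / V] and [c = 2 * C / V ^+ 2] this is [Bp C Lp V]. *)
Let B := Num.max (r / 2) (c / r).

(** The bound [c / r <= e t] lets [c] absorb only one of the two copies of [r * e t]; the bound
    [r / 2 <= e t] makes the right side nonnegative, so squares can be compared. *)
Lemma descent_decrease t : B <= e t -> e t.+1 <= e t - r / 2.
Proof.
rewrite ge_max (ler_pdivrMr _ c r_gt0) => /andP[h1 h2].
rewrite -(@ler_pXn2r _ 2) ?nnegrE ?subr_ge0//.
by apply: le_trans (e_step t) _; have := sqr_ge0 r; lra.
Qed.

Lemma descent_increase t : e t.+1 <= e t + Num.sqrt c.
Proof.
have c0 := ltW c_gt0.
rewrite -(@ler_pXn2r _ 2) ?nnegrE ?addr_ge0 ?sqrtr_ge0//.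
apply: le_trans (e_step t) _; rewrite sqrrD sqr_sqrtr//.
have := mulr_ge0 (ltW r_gt0) (e_ge0 t).
have := mulr_ge0 (e_ge0 t) (sqrtr_ge0 c); lra.
Qed.

(** Otherwise [e] would drop by [r / 2] at every step and become negative. *)
Lemma descent_hit : exists t, e t <= B + Num.sqrt c.
Proof.
have [//|/forallNP nh] := pselect (exists t, e t <= B + Num.sqrt c).
have dec t : e t <= e 0%N - t%:R * (r / 2).
  elim: t => [|t IH]; first by rewrite mul0r subr0.
  have /descent_decrease h : B <= e t.
    by have /negP := nh t; rewrite -ltNge; have := sqrtr_ge0 c; lra.
  by rewrite -natr1; lra.
pose k := Num.Def.archi_bound (e 0%N / (r / 2)).
have : e 0%N / (r / 2) < k%:R by rewrite archi_boundP// divr_ge0// divr_ge0 ?ltW.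
rewrite ltr_pdivrMr ?divr_gt0// => kk.
by have := dec k; have := e_ge0 k; lra.
Qed.

(** From above [B] the next value is smaller; from below [B] it gains at most [Num.sqrt c]. *)
Lemma descent_stay t0 t : (t0 <= t)%N -> e t0 <= B + Num.sqrt c ->
  e t <= B + Num.sqrt c.
Proof.
move=> /subnKC <- e0; elim: (t - t0)%N => [|k IH]; first by rewrite addn0.
rewrite addnS; have [/descent_decrease h|h] := leP B (e (t0 + k)%N).
  by have := r_gt0; lra.
by have := descent_increase (t0 + k); lra.
Qed.

End Descent.

(** * The Lagrangian dual function and weak duality *)

Section WeakDuality.
Variables (R : realType) (I J : nat) (X Y : set 'rV[R]_I).
Variables (f : 'rV[R]_I -> R) (g : 'rV[R]_I -> 'rV[R]_J) (M C : R).
Hypotheses (X_nonempty : X !=set0) (hullX_sub_Y : convex_hull X `<=` Y).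
Hypotheses (M_gt0 : 0 < M) (C_gt0 : 0 < C) (f_lipschitz : lipschitz_in M Y f).
Hypothesis g_bound : forall y, Y y -> enorm (g y) ^+ 2 <= C.
Hypothesis diam_bound : forall x y, convex_hull X x -> Y y ->
  enorm (x - y) ^+ 2 <= C.

Let le_sqrtC n (u : 'rV[R]_n) : enorm u ^+ 2 <= C -> enorm u <= Num.sqrt C.
Proof.
move=> h; apply: le_enorm; first exact: sqrtr_ge0.
by rewrite sqr_sqrtr -?enorm_sqr ?h ?ltW.
Qed.

(** The real [inf] bounds its set from below only if the set has a lower bound. One comes from the
    Lipschitz estimate against a fixed point [a0] of [X] and Cauchy-Schwarz on the two linear
    terms. *)
Lemma dual_function_le l a b : convex_hull X a -> Y b ->
  dual_function X Y f g l <= f b + dot l.1 (g b) + dot l.2 (a - b).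
Proof.
move=> Xa Yb; apply: ge_inf; last by exists a => //; exists b.
have [a0 Xa0] := X_nonempty.
have Ha0 : convex_hull X a0 by exact: sub_gen_smallest.
exists (f a0 - M * Num.sqrt C - enorm l.1 * Num.sqrt C - enorm l.2 * Num.sqrt C).
move=> _ [a' Xa' [b' Yb' <-]].
have h1 := f_lipschitz (hullX_sub_Y Ha0) Yb'.
have h2 := ler_wpM2l (ltW M_gt0) (le_sqrtC (diam_bound Ha0 Yb')).
have h3 := ler_wpM2l (enorm_ge0 l.1) (le_sqrtC (g_bound Yb')).
have h4 := ler_wpM2l (enorm_ge0 l.2) (le_sqrtC (diam_bound Xa' Yb')).
have h5 := dot_ge l.1 (g b'); have h6 := dot_ge l.2 (a' - b').
have h7 := ler_norm (f a0 - f b').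
lra.
Qed.

(** The Lagrangian separates into a term in [x] and a term in [y], so separate minimizers minimize
    it jointly. *)
Lemma dual_function_attained l a b :
  is_minimizer (convex_hull X) (dot l.2) a ->
  is_minimizer Y (fun y => f y + dot l.1 (g y) - dot l.2 y) b ->
  dual_function X Y f g l = f b + dot l.1 (g b) + dot l.2 (a - b).
Proof.
move=> [Xa mina] [Yb minb]; apply/eqP; rewrite eq_le dual_function_le//=.
apply: lb_le_inf; first by exists (f b + dot l.1 (g b) + dot l.2 (a - b)), a => //; exists b.
move=> _ [a' Xa' [b' Yb' <-]].
by have := mina _ Xa'; have := minb _ Yb'; rewrite !dotE; lra.
Qed.

(** At a feasible [a], choose [x = y = a]: the coupling term vanishes and the constraint term is
    nonpositive. *)
Lemma weak_duality l : dual_domain l ->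
  ((dual_function X Y f g l)%:E <= opt_value X f g)%E.
Proof.
move=> l0; apply/ereal_infP => _ [a [Xa ga] <-]; rewrite lee_fin.
apply: le_trans (dual_function_le l Xa (hullX_sub_Y Xa)) _.
rewrite subrr -(scale0r 0) dotZr mul0r addr0 gerDl.
by apply: sumr_le0 => j _; apply: mulr_ge0_le0.
Qed.

End WeakDuality.

(** * Convergence of the averages taken from the first hit *)

Theorem theorem2 (R : realType) (I J : nat) (I_gt0 : (0 < I)%N)
    (J_gt0 : (0 < J)%N)
    (X Y : set 'rV[R]_I)
    (X_nonempty : X !=set0) (X_closed : closed X) (X_bounded : bounded_set X)
    (Y_closed : closed Y) (Y_bounded : bounded_set Y)
    (Y_convex : @convex_set R 'rV[R]_I Y)
    (hullX_sub_Y : convex_hull X `<=` Y)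
    (f : 'rV[R]_I -> R) (g : 'rV[R]_I -> 'rV[R]_J)
    (f_convex : @convex_function R 'rV[R]_I Y f)
    (g_convex : forall j : 'I_J,
      @convex_function R 'rV[R]_I Y (fun y => g y 0 j))
    (M : R) (M_gt0 : 0 < M)
    (f_lipschitz : lipschitz_in M Y f)
    (g_lipschitz : forall j : 'I_J, lipschitz_in M Y (fun y => g y 0 j))
    (C : R) (C_gt0 : 0 < C)
    (g_bound : forall y, Y y -> enorm (g y) ^+ 2 <= C)
    (diam_bound : forall x y, convex_hull X x -> Y y ->
      enorm (x - y) ^+ 2 <= C)
    (lstar : 'rV[R]_J * 'rV[R]_I)
    (lstar_max : is_unique_maximizer (@dual_domain R J I)
      (dual_function X Y f g) lstar)
    (Lp : R) (Lp_gt0 : 0 < Lp)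
    (polyhedral : forall l : 'rV[R]_J * 'rV[R]_I, dual_domain l ->
      dual_function X Y f g lstar
        >= dual_function X Y f g l + Lp * pnorm (l - lstar))
    (V : R) (V_gt0 : 0 < V)
    (x y : nat -> 'rV[R]_I) (w : nat -> 'rV[R]_J) (z : nat -> 'rV[R]_I)
    (run : dual_subgradient_run X Y f g V x y w z) :
  exists Tp : nat,
    is_first_hit (Rp C Lp V lstar) (fun t => (w t, z t)) Tp /\
    forall T : nat, (0 < T)%N ->
      ((f (average_from x Tp T))%:E - opt_value X f g <=
        (C / V
         + 2 * V * M / T%:R * (Num.sqrt (2 * C) / V + Bp C Lp V)
         + V / (2 * T%:R)
           * ((Num.sqrt (2 * C) / V + Bp C Lp V) ^+ 2
              + 4 * pnorm lstar * (Num.sqrt (2 * C) / V + Bp C Lp V)))%:E)%E /\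
      (forall j : 'I_J,
        g (average_from x Tp T) 0 j <=
          2 * V * (1 + M) / T%:R * (Num.sqrt (2 * C) / V + Bp C Lp V)).
Proof.
have [w0 {}run] := run.
have xX t : convex_hull X (x t) by have [[? _] _ _ _] := run t; exact: sub_gen_smallest.
have yY t : Y (y t) by have [_ []] := run t.
have lam_dom t : dual_domain (w t, z t).
  case: t => [|t] //= j; have [_ _ -> _] := run t.
  by rewrite mxE le_max lexx.
have [lstar_dom _ _] := lstar_max.
pose lam t := row_mx (w t) (z t).
pose ls := row_mx lstar.1 lstar.2.
(* The subgradient of the dual function at [lam t]. *)
pose h t := row_mx (g (y t)) (x t - y t).
have h_sqr t : enorm (h t) ^+ 2 <= 2 * C.
  by rewrite enorm_row_mx; have := g_bound _ (yY t);
    have := diam_bound _ _ (xX t) (yY t); lra.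
have dualE t : dual_function X Y f g (w t, z t) = f (y t) + dot (lam t) (h t).
  have [[_ xmin] ymin _ _] := run t.
  by rewrite (@dual_function_attained R I J X Y f g M C _ _ _ _ _ _ _ _ (x t) (y t))//
    dot_row_mx addrA.
(* The reference point stays arbitrary: the dual optimum serves for the distance recursion, the
   origin for the objective. *)
have lam_step t (a : 'rV_J) (b : 'rV_I) : (forall j, 0 <= a 0 j) ->
    enorm (lam t.+1 - row_mx a b) ^+ 2 <=
    enorm (lam t - row_mx a b) ^+ 2
    + 2 / V * dot (lam t - row_mx a b) (h t) + 2 * C / V ^+ 2.
  move=> a0; have [_ _ wS zS] := run t.
  have -> : 2 * C / V ^+ 2 = V^-1 ^+ 2 * (2 * C) by field; rewrite gt_eqF.
  apply: le_trans (_ : _ <= enorm (lam t + V^-1 *: h t - row_mx a b) ^+ 2) _.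
    rewrite /lam /h scale_row_mx add_row_mx !subr_row_mx !enorm_row_mx wS zS.
    by rewrite lerD2r enorm_map_max0.
  by rewrite enorm_sqrBZ lerD2l ler_wpM2l ?sqr_ge0.
pose e t := enorm (lam t - ls).
have eE t : pnorm ((w t, z t) - lstar) = e t.
  by rewrite pnormE /e /lam /ls subr_row_mx.
pose r := Lp / V; pose c := 2 * C / V ^+ 2.
have r_gt0 : 0 < r by rewrite divr_gt0.
have c_gt0 : 0 < c by rewrite divr_gt0 ?exprn_gt0 ?mulr_gt0.
have e_ge0 t : 0 <= e t by exact: enorm_ge0.
(* Comparing the Lagrangian at [(x t, y t)] for both multipliers with polyhedral growth gives
   [dot (lam t - ls) (h t) <= - (Lp * e t)]. *)
have e_step t : e t.+1 ^+ 2 <= e t ^+ 2 - 2 * r * e t + c.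
  apply: le_trans (lam_step t lstar.1 lstar.2 lstar_dom) _.
  have := polyhedral _ (lam_dom t); rewrite eE dualE => h1.
  have := dual_function_le X_nonempty hullX_sub_Y M_gt0 C_gt0 f_lipschitz
    g_bound diam_bound lstar (xX t) (yY t).
  rewrite -addrA -dot_row_mx -/ls -/(h t) => h2.
  have -> : 2 * r * e t = 2 / V * (Lp * e t) by rewrite /r; field; rewrite gt_eqF.
  rewrite lerD2r lerD2l -mulrN.
  rewrite ler_pM2l ?divr_gt0// !dotE; lra.
pose K : R := Num.sqrt (2 * C) / V + Bp C Lp V.
have KE : Num.max (r / 2) (c / r) + Num.sqrt c = K.
  rewrite addrC; congr (_ + Num.max _ _); rewrite /c /r.
  - by rewrite sqrtrM ?mulr_ge0 ?ltW// sqrtrV ?sqr_ge0// sqrtr_sqr gtr0_norm.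
  - by field; rewrite gt_eqF.
  - by field; rewrite !gt_eqF.
have hitE t : Rp C Lp V lstar (w t, z t) <-> e t <= K.
  by rewrite /Rp /= eE addrC -/K; split=> [[]|].
have exhit : exists t, e t <= K.
  by have := descent_hit r_gt0 e_ge0 e_step; rewrite KE.
have [Tp hTp minTp] := ex_minnP exhit.
exists Tp; split.
  split=> [|t]; first exact/hitE.
  by rewrite ltnNge => /negP tTp /hitE /minTp.
have eK t : (Tp <= t)%N -> e t <= K.
  by move=> /(descent_stay r_gt0 c_gt0 e_ge0 e_step); rewrite KE; apply.
(* From here on the averages have [T.+1] terms. *)
case=> [//|T] _; rewrite -/K.
pose n : R := T.+1%:R; have n_gt0 : 0 < n by rewrite ltr0n.
pose xb := average_from x Tp T.+1; pose yb := average_from y Tp T.+1.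
have hXcvx := @convex_hull_convex R I X.
have xbX : convex_hull X xb by exact: average_from_in.
have ybY : Y yb by exact: average_from_in.
(* Both iterates lie in the ball of radius [K] around [ls]. *)
have lamK : enorm (lam (Tp + T.+1)%N - lam Tp) <= 2 * K.
  have -> : lam (Tp + T.+1)%N - lam Tp = lam (Tp + T.+1)%N - ls - (lam Tp - ls).
    by rewrite opprB addrA subrK.
  apply: le_trans (enormD _ _) _; rewrite enormN.
  by have := eK Tp (leqnn _); have := eK (Tp + T.+1)%N (leq_addr _ _); rewrite /e; lra.
(* The updates of [z] telescope, so the gap of the averages is a scaled difference of two
   iterates. *)
have xyK : enorm (xb - yb) <= 2 * V * K / n.
  have -> : xb - yb = (V / n) *: (z (Tp + T.+1)%N - z Tp).
    rewrite /xb /yb /average_from -scalerBr -sumrB mulrC -scalerA; congr (_ *: _).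
    rewrite -telescope_sumr ?leq_addr// scaler_sumr; apply: eq_bigr => t _.
    have [_ _ _ ->] := run t.
    by rewrite addrAC subrr add0r scalerA divff ?scale1r// gt_eqF.
  have Vn : 0 <= V / n by rewrite divr_ge0 ?ltW.
  rewrite enormZ//; have -> : 2 * V * K / n = V / n * (2 * K) by field; rewrite gt_eqF.
  apply: ler_wpM2l => //; apply: le_trans lamK.
  by rewrite /lam subr_row_mx enorm_row_mx_r.
have xyM : M * enorm (xb - yb) <= 2 * V * M / n * K.
  have -> : 2 * V * M / n * K = M * (2 * V * K / n) by field; rewrite gt_eqF.
  by have := ler_wpM2l (ltW M_gt0) xyK.

(* Constraint violation *)
split; last first.
  move=> j.
  have := g_lipschitz j _ _ (hullX_sub_Y _ xbX) ybY.
  have := ler_norm (g xb 0 j - g yb 0 j).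
  have := jensen_average_from Tp T Y_convex (g_convex j) yY; rewrite -/yb -/n.
  (* The positive part dominates its argument, so [g (y t)] is at most [V] times the increment of
     [w], and the sum telescopes. *)
  have : n^-1 * (\sum_(Tp <= t < Tp + T.+1) g (y t) 0 j) <= 2 * V * K / n.
    rewrite mulrC ler_pM2r ?invr_gt0//.
    apply: le_trans (_ : V * (w (Tp + T.+1)%N 0 j - w Tp 0 j) <= _).
      rewrite -(@telescope_sumr _ _ _ (fun t => w t 0 j)) ?leq_addr//.
      rewrite mulr_sumr; apply: ler_sum => t _.
      have [_ _ -> _] := run t; rewrite !mxE -ler_pdivrMl// lerBrDl.
      by rewrite le_max lexx orbT.
    rewrite (mulrC 2) -mulrA ler_pM2l//; apply: le_trans lamK.
    rewrite /lam subr_row_mx; apply: le_trans (enorm_row_mx_l _ _).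
    by have := le_coord_enorm (w (Tp + T.+1)%N - w Tp) j; rewrite !mxE.
  have -> : 2 * V * (1 + M) / n * K = 2 * V * K / n + 2 * V * M / n * K.
    by field; rewrite gt_eqF.
  by rewrite -/xb; clearbody n K; lra.
(* For an infeasible program the left side is [-oo]. *)
have [->|optfin] := eqVneq (opt_value X f g) +oo%E; first by rewrite addeNy leNye.
have wd t := weak_duality X_nonempty hullX_sub_Y M_gt0 C_gt0 f_lipschitz
    g_bound diam_bound (lam_dom t).
(* Weak duality at an iterate rules out [-oo]. *)
have : opt_value X f g \is a fin_num.
  rewrite fin_numE optfin andbT; apply/eqP => optN.
  by have := wd 0%N; rewrite optN leeNy_eq.
move=> /fineK optE; rewrite -optE -EFinB lee_fin pnormE -/xb -/ls -/n.
set fo := fine _ in optE *.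
(* The step inequality at the origin bounds [- dot (lam t) (h t)]; weak duality bounds
   [f (y t) + dot (lam t) (h t)] by the optimum. *)
have f_le t : f (y t) <= fo + C / V
    + V / 2 * (enorm (lam t) ^+ 2 - enorm (lam t.+1) ^+ 2).
  have := wd t; rewrite -optE lee_fin dualE => h1.
  have zero_ge0 (j : 'I_J) : 0 <= (0 : 'rV[R]_J) 0 j by rewrite mxE.
  have := lam_step t 0 0 zero_ge0; rewrite row_mx0 !subr0.
  have V2 : 0 <= V / 2 by rewrite divr_ge0 ?ltW.
  move=> /(ler_wpM2l V2); rewrite !mulrDr => h2.
  have : V / 2 * (2 * C / V ^+ 2) = C / V by field; rewrite gt_eqF.
  have : V / 2 * (2 / V * dot (lam t) (h t)) = dot (lam t) (h t).
    by field; rewrite gt_eqF.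
  lra.
have sum_le : \sum_(Tp <= t < Tp + T.+1) f (y t) <=
    n * (fo + C / V) + V / 2 * (K ^+ 2 + 4 * enorm ls * K).
  apply: le_trans (ler_sum _ (fun t _ => f_le t)) _.
  rewrite big_split /= big_const_nat addKn iter_addr_0 -[_ *+ T.+1]mulr_natl lerD2l.
  rewrite -mulr_sumr ler_pM2l ?divr_gt0//.
  rewrite (@telescope_sumr_eq _ _ _ (fun t => - enorm (lam t) ^+ 2)) ?leq_addr//.
    by rewrite opprK addrC enorm_sqr_sub_le ?eK ?leq_addr.
  by move=> k _; rewrite opprK addrC.
(* Jensen bounds [f yb]; the Lipschitz estimate carries the bound over to [f xb]. *)
have h1 := jensen_average_from Tp T Y_convex f_convex yY; rewrite -/yb -/n in h1.
have h2 := f_lipschitz _ _ (hullX_sub_Y _ xbX) ybY.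
have h3 := ler_norm (f xb - f yb).
have n1_ge0 : 0 <= n^-1 by rewrite invr_ge0 ltW.
have h4 := ler_wpM2l n1_ge0 sum_le.
have h5 : n^-1 * (n * (fo + C / V) + V / 2 * (K ^+ 2 + 4 * enorm ls * K)) =
    fo + C / V + V / (2 * n) * (K ^+ 2 + 4 * enorm ls * K).
  by field; rewrite !gt_eqF.
rewrite h5 in h4; clearbody n K; lra.
Qed.
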